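(* On an input graph $G=(V,E,W)$ (finite, simple, undirected, with positive edge weights) with $M=|E|$ edges, the Sequential Optimized Path Cover algorithm (described in the context) has time complexity $O(M\cdot\log M)$.
   Context: A path cover of a graph $G=(V,E)$ is a set of paths in $G$ such that every vertex of $G$ belongs to exactly one of the paths; a path may consist of a single vertex. Sequential Optimized Path Cover algorithm. Input: a finite simple undirected graph $G=(V,E,W)$ with positive edge weights. Sort the edges in descending order of weight (ties broken arbitrarily) into a list $L$, and let $\mathrm{cover}$ be empty. Process the edges $e=\{u,v\}$ of $L$ in order, skipping those which have been removed from $L$ before being reached. For each processed edge $\{u,v\}$: (i) if neither $u$ nor $v$ is in any path in $\mathrm{cover}$, add the path consisting of the edge $\{u,v\}$ as a new path in $\mathrm{cover}$; (ii) else if $u$ is an endpoint of a path in $\mathrm{cover}$ and $v$ is not in any path, extend that path by the edge $\{u,v\}$, so that $v$ becomes an endpoint, and remove from $L$ all edges incident to $u$ in $G$ that are not in $\mathrm{cover}$; (iii) else if $v$ is an endpoint of a path in $\mathrm{cover}$ and $u$ is not in any path, extend that path by the edge $\{u,v\}$, so that $u$ becomes an endpoint, and remove from $L$ all edges incident to $v$ in $G$ that are not in $\mathrm{cover}$; (iv) else if $u$ and $v$ are endpoints of two different paths in $\mathrm{cover}$, merge these two paths through the edge $\{u,v\}$, and remove from $L$ all edges incident to $u$ or to $v$ in $G$ that are not in $\mathrm{cover}$; (v) otherwise do nothing. At the end, output $\mathrm{cover}$ (the paths with at least one edge; vertices contained in no path are implicitly single-vertex paths and are not listed). Time is counted in elementary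 operations, where comparing two weights and a single lookup, insertion or deletion in a dictionary (hash table) indexed by vertices or edges each cost $O(1)$. *)

(* Defs.v *)
From mathcomp Require Import all_boot all_order all_algebra.
From mathcomp Require Import finmap reals.

Set Implicit Arguments.
Unset Strict Implicit.
Unset Printing Implicit Defensive.

Import Order.TTheory GRing.Theory Num.Theory.

Section Graph.
Variables (V : finType) (R : realType).

Record wgraph := WGraph {
  edges : {set {set V}};
  weight : {set V} -> R; (* relevant on [edges] only *)
  edges_card2 : forall e, e \in edges -> #|e| = 2%N;
  weight_gt0 : forall e, e \in edges -> (0 < weight e)%R }.

(* An edge {u, v} is written down as one of the pairs (u, v), (v, u). *)
Definition edge (p : V * V) : {set V} := [set p.1; p.2].

(* [s] lists every edge of [G] exactly once. *)
Definition edge_list (G : wgraph) (s : seq (V * V)) : bool :=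
  perm_eq [seq edge p | p <- s] (enum (edges G)).

Definition incident (G : wgraph) (u : V) : {set {set V}} :=
  [set e in edges G | u \in e].

End Graph.

(* The algorithm on abstract covers. A path is the sequence of its vertices
   and stands for the same path as its reversal. *)
Section Algorithm.
Variables (V : finType) (R : realType) (G : wgraph V R).

Definition vpath := seq V.

Definition path_edges (p : vpath) : {set {set V}} :=
  if p is x :: q then [set e in pairmap (fun y z => edge (y, z)) x q] else set0.

Definition cover_edges (C : seq vpath) : {set {set V}} :=
  \bigcup_(p <- C) path_edges p.

Definition in_cover (C : seq vpath) (x : V) : bool := has (fun p => x \in p) C.

Definition is_endpoint (x : V) (p : vpath) : bool :=
  if p is y :: q then (x == y) || (x == last y q) else false.

Definition endpoint_in (C : seq vpath) (x : V) : bool := has (is_endpoint x) C.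

(* The path of C with endpoint x (the empty sequence if there is none). *)
Definition path_at (C : seq vpath) (x : V) : vpath :=
  nth [::] C (find (is_endpoint x) C).

(* p, traversed so as to end at its endpoint x. *)
Definition ending_at (x : V) (p : vpath) : vpath :=
  if last x p == x then p else rev p.

(* Processing {u, v}: the new cover, and the edges that are removed from L. *)
Definition step (u v : V) (C : seq vpath) : seq vpath * {set {set V}} :=
  if ~~ in_cover C u && ~~ in_cover C v then ([:: u; v] :: C, set0)
  else if endpoint_in C u && ~~ in_cover C v then
    let p := path_at C u in
    let C' := rcons (ending_at u p) v :: rem p C in
    (C', incident G u :\: cover_edges C')
  else if endpoint_in C v && ~~ in_cover C u then
    let p := path_at C v in
    let C' := rcons (ending_at v p) u :: rem p C in
    (C', incident G v :\: cover_edges C')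
  else if [&& endpoint_in C u, endpoint_in C v & path_at C u != path_at C v]
  then
    let p := path_at C u in
    let q := path_at C v in
    let C' := (ending_at u p ++ rev (ending_at v q)) :: rem q (rem p C) in
    (C', (incident G u :|: incident G v) :\: cover_edges C')
  else (C, set0).

(* D is the set of the edges removed from the list so far. *)
Fixpoint run (L : seq (V * V)) (D : {set {set V}}) (C : seq vpath) :
    seq vpath :=
  if L is (u, v) :: L' then
    if edge (u, v) \in D then run L' D C
    else let: (C', X) := step u v C in run L' (D :|: X) C'
  else C.

(* [out] is, up to the order and the orientation of the paths, an output of the
   algorithm on G, for some way of breaking ties. *)
Definition sopc_output (out : seq vpath) : Prop :=
  exists L : seq (V * V),
    [/\ edge_list G L,
        sorted (fun e f => weight G (edge f) <= weight G (edge e))%R L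
      & perm_eq [seq path_edges p | p <- out]
                [seq path_edges p | p <- run L set0 [::]]].

End Algorithm.

(* A value together with the number of elementary operations spent on it. *)
Record cost (A : Type) := Cost { value : A; time : nat }.

Definition ret {A : Type} (a : A) : cost A := Cost a 0.
Definition bind {A B : Type} (m : cost A) (k : A -> cost B) : cost B :=
  let r := k (value m) in Cost (value r) (time m + time r).
Definition tick {A : Type} (a : A) : cost A := Cost a 1.

Notation "'let!' x ':=' m 'in' k" := (bind m (fun x => k))
  (at level 200, x strict pattern, m at level 100, k at level 200,
   right associativity).

Section Dictionary.
Variables (K : choiceType) (T : Type).
Local Open Scope fmap_scope.

Definition lookup (k : K) (d : {fmap K -> T}) : cost (option T) :=
  tick (d.[? k]).
Definition insert (k : K) (x : T) (d : {fmap K -> T}) : cost {fmap K -> T} :=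
  tick (d.[k <- x]).
Definition delete (k : K) (d : {fmap K -> T}) : cost {fmap K -> T} :=
  tick (d.[~ k]).

End Dictionary.

(* The implementation. Every dictionary operation, weight lookup or comparison,
   list cell or tree node read or built, and recursive call is charged; the rest
   is a bounded amount of branching on values already at hand. *)
Section Sorting.
Variables (T : Type) (before : T -> T -> cost bool).

Fixpoint halve (s : seq T) : cost (seq T * seq T) :=
  if s is x :: s' then let! h := halve s' in tick (x :: h.2, h.1)
  else tick ([::], [::]).

Fixpoint merge_runs (s1 : seq T) : seq T -> cost (seq T) :=
  if s1 is x :: s1' then
    fix merge_x s2 :=
      if s2 is y :: s2' then
        let! b := before x y in
        if b then let! r := merge_runs s1' s2 in tick (x :: r)
        else let! r := merge_x s2' in tick (y :: r)
      else tick s1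
  else fun s2 => tick s2.

(* [n] only bounds the depth of the recursion; [n = size s] is enough. *)
Fixpoint merge_sort (n : nat) (s : seq T) : cost (seq T) :=
  match n, s with
  | n'.+1, _ :: _ :: _ =>
      let! h := halve s in
      let! s1 := merge_sort n' h.1 in
      let! s2 := merge_sort n' h.2 in
      merge_runs s1 s2
  | _, _ => tick s
  end.

End Sorting.

(* Paths as concatenation trees, joined in constant time. *)
Inductive rope (V : Type) := Single of V | Join of rope V & rope V.
Arguments Single {V}.
Arguments Join {V}.

(* The vertices of r, in order, followed by acc. *)
Fixpoint vertices (V : Type) (r : rope V) (acc : seq V) : cost (seq V) :=
  match r with
  | Single x => tick (x :: acc)
  | Join r1 r2 =>
      let! acc' := vertices r2 acc in
      let! p := vertices r1 acc' in
      tick p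
  end.

Section Implementation.
Variables (V : finType) (R : realType).
Variables (w : {set V} -> R) (tie : V * V -> V * V -> bool).

Record state := State {
  in_list : {fmap {set V} -> unit};   (* the edges not removed from L *)
  on_path : {fmap V -> unit};         (* the vertices on some path *)
  path_edge : {fmap {set V} -> unit}; (* the edges on some path *)
  (* maps each endpoint x of a path to its other endpoint y, and to the path
     traversed from x to y *)
  ends : {fmap V -> V * rope V} }.

Definition before (e f : V * V) : cost bool :=
  let! a := tick (w (edge e)) in
  let! b := tick (w (edge f)) in
  tick ((b < a)%R || ((a == b) && tie e f)).

Fixpoint fill_list (s : seq (V * V)) (d : {fmap {set V} -> unit}) :
    cost {fmap {set V} -> unit} :=
  if s is e :: s' then
    let! d' := insert (edge e) tt d in
    let! d'' := fill_list s' d' in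
    tick d''
  else tick d.

Definition add_neighbour (u v : V) (adj : {fmap V -> seq V}) :
    cost {fmap V -> seq V} :=
  let! o := lookup u adj in
  let! l := tick (v :: odflt [::] o) in
  insert u l adj.

Fixpoint fill_adj (s : seq (V * V)) (adj : {fmap V -> seq V}) :
    cost {fmap V -> seq V} :=
  if s is (u, v) :: s' then
    let! adj1 := add_neighbour u v adj in
    let! adj2 := add_neighbour v u adj1 in
    let! adj' := fill_adj s' adj2 in
    tick adj'
  else tick adj.

Section Processing.
Variable adj : {fmap V -> seq V}.

Fixpoint remove_edges (u : V) (l : seq V) (pe d : {fmap {set V} -> unit}) :
    cost {fmap {set V} -> unit} :=
  if l is x :: l' then
    let! o := lookup (edge (u, x)) pe in
    let! d' := (if o is Some _ then tick d else delete (edge (u, x)) d) in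
    let! d'' := remove_edges u l' pe d' in
    tick d''
  else tick d.

Definition remove_incident (u : V) (st : state) : cost state :=
  let! o := lookup u adj in
  let! d := remove_edges u (odflt [::] o) (path_edge st) (in_list st) in
  tick (State d (on_path st) (path_edge st) (ends st)).

(* Starts the path {u, v}. *)
Definition new_path (u v : V) (st : state) : cost state :=
  let! op := insert u tt (on_path st) in
  let! op' := insert v tt op in
  let! pe := insert (edge (u, v)) tt (path_edge st) in
  let! en := insert u (v, Join (Single u) (Single v)) (ends st) in
  let! en' := insert v (u, Join (Single v) (Single u)) en in
  tick (State (in_list st) op' pe en').

(* The path from u to a, given by ru, is extended by the edge {u, v}. *)
Definition extend (u v a : V) (ru : rope V) (st : state) : cost state :=
  let! o := lookup a (ends st) in
  let ra := (odflt (u, Single a) o).2 in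
  let! op := insert v tt (on_path st) in
  let! pe := insert (edge (u, v)) tt (path_edge st) in
  let! en := delete u (ends st) in
  let! en1 := insert a (v, Join ra (Single v)) en in
  let! en2 := insert v (a, Join (Single v) ru) en1 in
  remove_incident u (State (in_list st) op pe en2).

(* The paths from u to a and from v to b, given by ru and rv, are merged through
   the edge {u, v}. *)
Definition merge_paths (u v a b : V) (ru rv : rope V) (st : state) :
    cost state :=
  let! oa := lookup a (ends st) in
  let! ob := lookup b (ends st) in
  let ra := (odflt (u, Single a) oa).2 in
  let rb := (odflt (v, Single b) ob).2 in
  let! pe := insert (edge (u, v)) tt (path_edge st) in
  let! en := delete u (ends st) in
  let! en1 := delete v en in
  let! en2 := insert a (b, Join ra rv) en1 in
  let! en3 := insert b (a, Join rb ru) en2 in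
  let! st' := remove_incident u (State (in_list st) (on_path st) pe en3) in
  remove_incident v st'.

Definition process (u v : V) (st : state) : cost state :=
  let! present := lookup (edge (u, v)) (in_list st) in
  if present is None then ret st else
  let! pu := lookup u (on_path st) in
  let! pv := lookup v (on_path st) in
  let! eu := lookup u (ends st) in
  let! ev := lookup v (ends st) in
  match pu, pv, eu, ev with
  | None, None, _, _ => new_path u v st
  | _, None, Some (a, ru), _ => extend u v a ru st
  | None, _, _, Some (b, rv) => extend v u b rv st
  | _, _, Some (a, ru), Some (b, rv) =>
      (* u and v end the same path iff the other endpoint of u's path is v *)
      let! same := tick (a == v) in
      if same then ret st else merge_paths u v a b ru rv st
  | _, _, _, _ => ret st
  end.

Fixpoint process_all (L : seq (V * V)) (st : state) : cost state :=
  if L is (u, v) :: L' then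
    let! st' := process u v st in
    let! st'' := process_all L' st' in
    tick st''
  else tick st.

End Processing.

(* Moves the path with endpoint u, if any, from [en] to [out]. *)
Definition emit (u : V) (en : {fmap V -> V * rope V}) (out : seq (seq V)) :
    cost ({fmap V -> V * rope V} * seq (seq V)) :=
  let! o := lookup u en in
  if o is Some (a, r) then
    let! p := vertices r [::] in
    let! en1 := delete u en in
    let! en2 := delete a en1 in
    tick (en2, p :: out)
  else ret (en, out).

Fixpoint emit_all (s : seq (V * V)) (en : {fmap V -> V * rope V})
    (out : seq (seq V)) : cost (seq (seq V)) :=
  if s is (u, v) :: s' then
    let! r := emit u en out in
    let! r' := emit v r.1 r.2 in
    let! out' := emit_all s' r'.1 r'.2 in
    tick out'
  else tick out.

Definition sopc (s : seq (V * V)) : cost (seq (seq V)) :=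
  let! L := merge_sort before (size s) s in
  let! d := fill_list s [fmap]%fmap in
  let! adj := fill_adj s [fmap]%fmap in
  let! st := process_all adj L (State d [fmap]%fmap [fmap]%fmap [fmap]%fmap) in
  emit_all s (ends st) [::].

End Implementation.

(* Main.v *)
Require Import Defs.
From mathcomp Require Import all_boot all_order all_algebra.
From mathcomp Require Import finmap zify lra.
From mathcomp Require Import all_classical all_reals all_analysis.

Set Implicit Arguments.
Unset Strict Implicit.
Unset Printing Implicit Defensive.

Import Order.TTheory GRing.Theory Num.Theory.
Import numFieldNormedType.Exports.

(** The sorted list is handled by the dictionaries exactly as the abstract
    algorithm handles its list of paths, and every operation of the dictionaries
    is paid for either by the edge being processed or by the vertex whose edges
    are being removed.

    Correctness is a simulation. The relation [tracks C st] says that the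
    dictionaries of st describe the cover C: the paths of C are disjoint, and
    looking up a vertex x among the ends returns the path of C that starts at x,
    if there is one. The orientation of a path in C is arbitrary, hence the
    notion of a [traversal]. The three productive cases of a step all link a path
    ending at u to a path ending at v, where a vertex outside the cover counts as
    a path on its own; [tracks_link] treats them at once. [process_all_ok]
    follows the whole run, and [emit_all_ok] reads the paths off at the end.

    For the running time, merge sort needs about 5 M log M operations on M edges
    ([time_merge_sort]). Processing an edge takes a bounded number of operations,
    except for the removal of the edges incident to a vertex u, which takes time
    proportional to the degree of u. This happens only when u stops being an
    endpoint, and u is then interior to its path for ever; so it happens at most
    once for each vertex, and all removals together take time proportional to the
    sum of the degrees, that is, 2 M. The [potential] of a cover, summed over its
    interior vertices, carries this argument through the run. Since the vertices
    on the paths are among the 2 M ends of the edges, the output takes linear time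
    as well. The total is at most 5 k M + 51 M + 5 whenever M <= 2 ^ k
    ([time_sopc]). *)

(** * Merge sort *)

Section MergeSort.
#[local] Arguments merge_runs : simpl never.
Variables (T : eqType) (before : T -> T -> cost bool).

Lemma merge_runs_cons x s1 y s2 :
  merge_runs before (x :: s1) (y :: s2) =
  bind (before x y) (fun b =>
    if b then bind (merge_runs before s1 (y :: s2)) (fun r => tick (x :: r))
    else bind (merge_runs before (x :: s1) s2) (fun r => tick (y :: r))).
Proof. by []. Qed.

(** Follows the recursive calls of the merge. *)
Lemma merge_runs_ind (P : seq T -> seq T -> Prop) :
    (forall s, P [::] s) -> (forall s, P s [::]) ->
    (forall x s1 y s2, value (before x y) -> P s1 (y :: s2) ->
      P (x :: s1) (y :: s2)) ->
    (forall x s1 y s2, ~~ value (before x y) -> P (x :: s1) s2 ->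
      P (x :: s1) (y :: s2)) ->
  forall s1 s2, P s1 s2.
Proof.
move=> P0s Ps0 Pl Pr; elim=> [|x s1 IH1] s2; first exact: P0s.
elim: s2 => [|y s2 IH2]; first exact: Ps0.
by case: (boolP (value (before x y))) => b; [apply: Pl|apply: Pr].
Qed.

Lemma perm_merge_runs s1 s2 : perm_eq (value (merge_runs before s1 s2)) (s1 ++ s2).
Proof.
move: s1 s2; apply: merge_runs_ind => [s|[|x s]|x s1 y s2 b IH|x s1 y s2 b IH] //.
- by rewrite cats0.
- by rewrite merge_runs_cons /= b /= perm_cons.
- rewrite merge_runs_cons /= (negbTE b) /= perm_sym.
  by rewrite (perm_catCA (x :: s1) [:: y] s2) /= perm_cons perm_sym.
Qed.

Lemma halve_cons (x y : T) (s : seq T) :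
  value (halve [:: x, y & s]) = (x :: (value (halve s)).1, y :: (value (halve s)).2).
Proof. by []. Qed.

Lemma seq_pair_ind (P : seq T -> Prop) : P [::] -> (forall x, P [:: x]) ->
  (forall x y s, P s -> P [:: x, y & s]) -> forall s, P s.
Proof.
move=> P0 P1 P2 s.
suff [] : P s /\ forall x, P (x :: s) by [].
by elim: s => [//|x s [Ps Pxs]]; split=> // y; apply: P2.
Qed.

Lemma size_halve (s : seq T) : size (value (halve s)).1 = uphalf (size s) /\
                     size (value (halve s)).2 = (size s)./2.
Proof. by elim/seq_pair_ind: s => //= x y s [-> ->]. Qed.

Lemma perm_halve (s : seq T) :
  perm_eq ((value (halve s)).1 ++ (value (halve s)).2) s.
Proof.
elim/seq_pair_ind: s => // x y s IH; rewrite halve_cons /= perm_cons.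
by rewrite (perm_catCA _ [:: y]) /= perm_cons.
Qed.

Lemma time_halve (s : seq T) : time (halve s) = (size s).+1.
Proof. by elim: s => //= x s ->; lia. Qed.

Lemma merge_sort_rec n (x y : T) s (t := [:: x, y & s]) :
  merge_sort before n.+1 t =
  bind (halve t) (fun h => bind (merge_sort before n h.1) (fun s1 =>
    bind (merge_sort before n h.2) (fun s2 => merge_runs before s1 s2))).
Proof. by []. Qed.

Lemma perm_merge_sort n s : perm_eq (value (merge_sort before n s)) s.
Proof.
elim: n s => [|n IH] [|x [|y s]] //; rewrite merge_sort_rec /bind.
set h := halve _; rewrite [value _]/=.
apply: perm_trans (perm_merge_runs _ _) _.
by apply: perm_trans (perm_halve [:: x, y & s]); apply: perm_cat.
Qed.

Section Sorted.
Variable le : rel T.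
Hypothesis before_le : forall x y, value (before x y) -> le x y.
Hypothesis not_before_le : forall x y, ~~ value (before x y) -> le y x.

Lemma merge_runs_path s1 s2 z :
  path le z s1 -> path le z s2 -> path le z (value (merge_runs before s1 s2)).
Proof.
move: s1 s2 z.
apply: merge_runs_ind => [s|[|x s]|x s1 y s2 b IH|x s1 y s2 b IH] z //;
  rewrite merge_runs_cons /=.
- by rewrite b /= => /andP[-> p1] /andP[_ p2]; rewrite IH //= before_le.
- rewrite (negbTE b) /= => /andP[_ p1] /andP[-> p2].
  by rewrite IH //= not_before_le.
Qed.

Lemma sorted_merge_runs s1 s2 :
  sorted le s1 -> sorted le s2 -> sorted le (value (merge_runs before s1 s2)).
Proof.
case: s1 s2 => [|x s1] [|y s2] //; rewrite merge_runs_cons /=.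
case: ifPn => [/before_le|/not_before_le] b p1 p2 /=;
  by apply: merge_runs_path => //=; rewrite b.
Qed.

(** Each half of a list with at least two elements is strictly shorter, so a
    depth equal to the length is never exhausted. *)
Lemma sorted_merge_sort n s :
  (size s <= n)%N -> sorted le (value (merge_sort before n s)).
Proof.
elim: n s => [|n IH] [|x [|y s]] // len; rewrite merge_sort_rec /bind.
set h := halve _; rewrite [value _]/=.
have [s1 s2] := size_halve [:: x, y & s].
by apply: sorted_merge_runs; apply: IH; rewrite ?s1 ?s2 /=; move: len => /=; lia.
Qed.

End Sorted.

Section Time.
Hypothesis time_before : forall x y, time (before x y) = 3%N.

Lemma time_merge_runs s1 s2 :
  (time (merge_runs before s1 s2) <= (size s1 + size s2) * 4 + 1)%N.
Proof.
move: s1 s2.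
apply: merge_runs_ind => [s|[|x s]|x s1 y s2 b|x s1 y s2 b]; rewrite addn1 //;
  rewrite merge_runs_cons /= time_before ?b ?(negbTE b) /=; lia.
Qed.

(** One level of the recursion spends 5m + 2 operations on a list of length m,
    and a list of length at most 2^k is exhausted after k levels; the terms
    3m - 2 absorb the additive constants, as the lengths of the halves add up to
    m. *)
Lemma time_merge_sort k n s : (0 < size s <= 2 ^ k)%N ->
  (time (merge_sort before n s) + 2 <= 5 * k * size s + 3 * size s)%N.
Proof.
elim: k n s => [|k IH] n s; first by case: n s => [|n] [|x [|y s]] //=; lia.
case: n s => [|n] [|x [|y s]] // len; try by rewrite /=; lia.
rewrite merge_sort_rec /bind; set h := halve _; rewrite [time _]/= time_halve.
have [e1 e2] := size_halve [:: x, y & s]; rewrite -/h in e1 e2.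
set s1 := merge_sort _ _ _; set s2 := merge_sort _ _ (value h).2.
have t1 := IH n (value h).1; have t2 := IH n (value h).2.
have t3 := time_merge_runs (value s1) (value s2).
have p1 := perm_size (perm_merge_sort n (value h).1).
have p2 := perm_size (perm_merge_sort n (value h).2).
rewrite -/s1 in p1 t1; rewrite -/s2 in p2 t2; rewrite {}p1 {}p2 in t3.
rewrite !e1 !e2 in t1 t2 t3; rewrite expnS in len.
set m := size [:: x, y & s] in t1 t2 t3 len *.
have m2 : (1 < m)%N by [].
have h12 : m = (uphalf m + m./2)%N by rewrite uphalfE; lia.
have {}t1 := t1 ltac:(lia); have {}t2 := t2 ltac:(lia).
have e : (5 * k * m = 5 * k * uphalf m + 5 * k * m./2)%N by rewrite -mulnDr -h12.
have {}e : (5 * k.+1 * m = 5 * k * uphalf m + 5 * k * m./2 + 5 * m)%N.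
  by rewrite -e mulnS mulnDl addnC.
have em : m = (size s).+2 by [].
rewrite {}e; move: t1 t2 t3 h12 em; clearbody m.
move: (5 * k * _)%N (5 * k * _)%N (time _) (time _) (time _) => a b c1 c2 c3.
lia.
Qed.

End Time.
End MergeSort.

(** * Ropes *)

Section Ropes.
Variable V : Type.
Implicit Type r : rope V.

Definition flat r : seq V := value (vertices r [::]).

Lemma verticesE r acc : value (vertices r acc) = flat r ++ acc.
Proof.
rewrite /flat; elim: r acc => //= r1 IH1 r2 IH2 acc.
by rewrite IH1 IH2 [in RHS]IH1 catA.
Qed.

Lemma flat_join r1 r2 : flat (Join r1 r2) = flat r1 ++ flat r2.
Proof. by rewrite -[RHS]verticesE. Qed.

Lemma time_vertices r acc : (time (vertices r acc)).+1 = (size (flat r)).*2.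
Proof.
elim: r acc => //= r1 IH1 r2 IH2 acc; rewrite flat_join size_cat doubleD.
by rewrite -(IH1 (value (vertices r2 acc))) -(IH2 acc); lia.
Qed.

End Ropes.

(** * Paths and covers *)

Section Paths.
Variable V : finType.
Implicit Types (C D : seq (seq V)) (p q t : seq V) (u v x y : V).
Implicit Types (e : {set V}) (o : option (V * rope V)).

Lemma edgeC u v : edge (u, v) = edge (v, u).
Proof. exact: finset.setUC. Qed.

Lemma edge_inj (f g : V * V) : edge f = edge g -> f = g \/ f = (g.2, g.1).
Proof.
case: f g => [a b] [c d] E.
have mem x : (x == a) || (x == b) = (x == c) || (x == d).
  by have /setP/(_ x) := E; rewrite !inE.
have := mem a; have := mem b; have := mem c; have := mem d; rewrite !eqxx /= !orbT.
move=> /orP[/eqP d1|/eqP d1] /orP[/eqP c1|/eqP c1].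
- by subst c d => /esym/orP[] /eqP ->; auto.
- by subst c d; auto.
- by subst c d; auto.
- by subst c d => _ /esym/orP[] /eqP ->; auto.
Qed.

Lemma path_edges_cons2 x y q :
  path_edges (x :: y :: q) = edge (x, y) |: path_edges (y :: q).
Proof. by apply/setP => e; rewrite !inE. Qed.

Lemma path_edges1 x : path_edges [:: x] = finset.set0.
Proof. by apply/setP => e; rewrite !inE. Qed.

Lemma path_edges_cat p x y q :
  path_edges (rcons p x ++ y :: q) =
  edge (x, y) |: (path_edges (rcons p x) :|: path_edges (y :: q)).
Proof.
elim: p => [|z p IH]; first by rewrite path_edges1 finset.set0U path_edges_cons2.
case: p IH => [|z' p] IH; apply/setP => e.
  by rewrite !path_edges_cons2 path_edges1 !inE; do !bool_congr.
rewrite [rcons _ _]/= [_ ++ _]/= path_edges_cons2.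
rewrite -[z' :: _]/(rcons (z' :: p) x ++ y :: q) IH.
by rewrite path_edges_cons2 !inE; do !bool_congr.
Qed.

Lemma path_edges_rev p : path_edges (rev p) = path_edges p.
Proof.
elim: p => // x [|y p] IH //; rewrite rev_cons rev_cons -cats1 path_edges_cat.
by rewrite -rev_cons IH path_edges1 finset.setU0 path_edges_cons2 edgeC.
Qed.

Lemma is_endpointE x y q : is_endpoint x (y :: q) = (x == y) || (x == last y q).
Proof. by []. Qed.

Lemma is_endpoint_rev x p : is_endpoint x (rev p) = is_endpoint x p.
Proof.
case: p => // y q; case/lastP: q => [|q z] //.
by rewrite rev_cons rev_rcons rcons_cons !is_endpointE !last_rcons orbC.
Qed.

Lemma is_endpoint_mem x p : is_endpoint x p -> x \in p.
Proof. by case: p => // y q /orP[] /eqP ->; rewrite ?mem_head ?mem_last. Qed.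

Lemma in_coverE C x : in_cover C x = (x \in flatten C).
Proof. by apply/hasP/flattenP. Qed.

Lemma cover_edgesE C e : (e \in cover_edges C) = has (fun p => e \in path_edges p) C.
Proof.
rewrite /cover_edges; elim: C => [|p C IH]; first by rewrite big_nil inE.
by rewrite big_cons inE IH.
Qed.

Lemma endpoint_in_cover C x : endpoint_in C x -> in_cover C x.
Proof. by apply: sub_has => p /is_endpoint_mem. Qed.

Definition disjoint_paths C : bool :=
  uniq (flatten C) && all (fun p => 1 < size p)%N C.

Lemma disjoint_paths_perm C D :
  perm_eq C D -> disjoint_paths C = disjoint_paths D.
Proof.
move=> CD; rewrite /disjoint_paths (perm_all _ CD).
by rewrite (perm_uniq (perm_flatten CD)).
Qed.

Lemma disjoint_paths_cons p C : disjoint_paths (p :: C) ->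
  disjoint_paths C /\ forall x, x \in p -> x \notin flatten C.
Proof.
rewrite /disjoint_paths /= cat_uniq => /andP[/and3P[_ pC ->]] /andP[_ ->].
by split=> // x xp; apply: contra pC => xC; apply/hasP; exists x.
Qed.

Lemma path_unique C p q x : disjoint_paths C ->
  p \in C -> q \in C -> x \in p -> x \in q -> p = q.
Proof.
move=> dC pC qC xp xq; apply/eqP/negPn/negP => npq.
have pe := perm_to_rem pC; move: dC; rewrite (disjoint_paths_perm pe).
case/disjoint_paths_cons => _ /(_ x xp) /negP[]; apply/flattenP; exists q => //.
by move: qC; rewrite (perm_mem pe) inE eq_sym (negbTE npq).
Qed.

(** Up to orientation, p is a path of C. *)
Definition traversal C p : bool := (p \in C) || (rev p \in C).

Lemma traversal_rev C p : traversal C (rev p) = traversal C p.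
Proof. by rewrite /traversal revK orbC. Qed.

Lemma traversal_endpoint C x q : traversal C (x :: q) -> endpoint_in C x.
Proof.
case/orP => pC; apply/hasP.
  by exists (x :: q) => //=; rewrite eqxx.
by exists (rev (x :: q)); rewrite // is_endpoint_rev /= eqxx.
Qed.

Lemma traversal_disjoint C p : disjoint_paths C -> traversal C p ->
  uniq p && (1 < size p)%N.
Proof.
move=> dC; wlog pC : p / p \in C.
  move=> W /orP[|] pC; [|rewrite -rev_uniq -size_rev];
    by apply: W; rewrite // /traversal pC.
move=> _; move: dC; rewrite (disjoint_paths_perm (perm_to_rem pC)) /disjoint_paths.
by rewrite /= cat_uniq => /andP[/and3P[-> _ _] /andP[->]].
Qed.

Lemma path_atP C x q : disjoint_paths C -> traversal C (x :: q) ->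
  [/\ path_at C x \in C,
      path_at C x = x :: q \/ path_at C x = rev (x :: q)
    & ending_at x (path_at C x) = rev (x :: q)].
Proof.
move=> dC tC; have hx := traversal_endpoint tC.
have pC : path_at C x \in C by rewrite mem_nth // -has_find.
have xp : x \in path_at C x by apply: is_endpoint_mem; exact: nth_find.
have pE : path_at C x = x :: q \/ path_at C x = rev (x :: q).
  by case/orP: tC => tC; [left|right]; apply: path_unique dC pC tC xp _;
    rewrite ?mem_rev mem_head.
split=> //; rewrite /ending_at.
have /andP[/= /andP[xq _]] := traversal_disjoint dC tC.
case: pE => -> /=; last by rewrite rev_cons last_rcons eqxx.
case: q xq {tC} => //= y q xq _; case: eqVneq => // E.
by move: xq; rewrite -[in X in X \notin _]E mem_last.
Qed.

(** What the dictionary of ends should return at x when it represents C. *)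
Definition end_spec C x o : bool :=
  if o is Some (a, r) then
    [&& traversal C (flat r), head a (flat r) == x & last x (flat r) == a]
  else ~~ endpoint_in C x.

Lemma end_specS C x a r : all (fun p => 1 < size p)%N C ->
  end_spec C x (Some (a, r)) ->
  exists q, [/\ flat r = x :: q, last x q = a & traversal C (x :: q)].
Proof.
move=> sC /and3P[tC /eqP hx /eqP la].
case: (flat r) tC hx la => [|y q] tC /= hx la; last by subst y; exists q.
by case/orP: tC => /(allP sC).
Qed.

Lemma end_spec_endpoint C x o : all (fun p => 1 < size p)%N C ->
  end_spec C x o -> endpoint_in C x = o.
Proof.
case: o => [[a r]|] sC; last by move/negbTE.
by case/(end_specS sC) => q [_ _ /traversal_endpoint].
Qed.


(** The entry at x depends only on the path through x, here not in D. *)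
Lemma end_spec_outside C D x o : all (fun p => 1 < size p)%N (D ++ C) ->
  x \notin flatten D -> end_spec (D ++ C) x o -> end_spec C x o.
Proof.
move=> sC xD; case: o => [[a r]|]; last first.
  by rewrite /= /endpoint_in has_cat negb_or => /andP[].
move=> es; have [q [rE la tC]] := end_specS sC es.
rewrite /= rE /= la !eqxx !andbT.
have xnD p : x \in p -> p \notin D.
  by move=> xp; apply: contra xD => pD; apply/flattenP; exists p.
move: tC; rewrite /traversal !mem_cat (negbTE (xnD _ _)) ?mem_head //=.
by rewrite (negbTE (xnD _ _)) // mem_rev mem_head.
Qed.

Lemma end_spec_cons C t x o : x \notin t -> end_spec C x o -> end_spec (t :: C) x o.
Proof.
move=> xt; case: o => [[a r]|] /=; last first.
  by rewrite negb_or => ->; rewrite andbT; apply: contra xt => /is_endpoint_mem.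
by case/and3P; rewrite /traversal !inE => /orP[] -> -> ->; rewrite !orbT.
Qed.

(** No later step can change the path next to such a vertex. *)
Definition interior C : {set V} := [set x | in_cover C x && ~~ endpoint_in C x].

(** A path as it is listed in a cover: a single vertex is left out. *)
Definition nontrivial p : seq (seq V) := if (1 < size p)%N then [:: p] else [::].

Lemma flatten_nontrivial p x : x \in flatten (nontrivial p) -> x \in p.
Proof. by rewrite /nontrivial; case: ifP; rewrite //= cats0. Qed.

Lemma flatten_nontrivial_tail u q x : x \in q -> x \in flatten (nontrivial (u :: q)).
Proof. by case: q => // y q xq; rewrite /nontrivial /= cats0 inE xq orbT. Qed.

Lemma endpoint_nontrivial u q x : x \in flatten (nontrivial (u :: q)) ->
  endpoint_in (nontrivial (u :: q)) x = (x == u) || (x == last u q).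
Proof. by case: q => [|y q] //= _; rewrite orbF. Qed.

(** The path obtained by joining u :: q1, reversed, to v :: q2 by {u, v}. *)
Definition link u q1 v q2 : seq V := rev (u :: q1) ++ v :: q2.

Lemma path_edges_link u q1 v q2 : path_edges (link u q1 v q2) =
  edge (u, v) |: (path_edges (u :: q1) :|: path_edges (v :: q2)).
Proof. by rewrite /link rev_cons path_edges_cat -rev_cons path_edges_rev. Qed.

Lemma rev_link u q1 v q2 : rev (link u q1 v q2) = link v q2 u q1.
Proof. by rewrite /link rev_cat revK. Qed.

Lemma head_link x u q1 v q2 : head x (link u q1 v q2) = last u q1.
Proof.
rewrite /link; case/lastP: q1 => [|q1 y] //.
by rewrite rev_cons rev_rcons last_rcons.
Qed.

Lemma last_link x u q1 v q2 : last x (link u q1 v q2) = last v q2.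
Proof. by rewrite /link last_cat. Qed.

Lemma mem_link x u q1 v q2 :
  (x \in link u q1 v q2) = (x \in u :: q1) || (x \in v :: q2).
Proof. by rewrite /link mem_cat mem_rev. Qed.

Lemma endpoint_link x u q1 v q2 :
  is_endpoint x (link u q1 v q2) = (x == last u q1) || (x == last v q2).
Proof.
move: (head_link x u q1 v q2) (last_link x u q1 v q2).
case: (link _ _ _ _) (mem_link u u q1 v q2) => [|y p] /=.
  by rewrite mem_head.
by move=> _ -> ->.
Qed.

Lemma disjoint_link u q1 v q2 C : disjoint_paths (link u q1 v q2 :: C) =
  uniq ((u :: q1) ++ (v :: q2) ++ flatten C) && all (fun p => 1 < size p)%N C.
Proof.
rewrite /disjoint_paths [flatten _]/= [all _ _]/=.
have -> : (1 < size (link u q1 v q2))%N by rewrite /link size_cat size_rev /=; lia.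
congr (_ && _); apply: perm_uniq; rewrite /link -catA perm_cat2r.
exact: permEl (perm_rev _).
Qed.

(** Processing an edge {u, v} in any of the three productive ways amounts to
    the same thing: the path that ends at u and the one that ends at v, either
    of which may be a single vertex and hence not listed, are linked. *)
Section Link.
Variables (C : seq (seq V)) (u : V) (q1 : seq V) (v : V) (q2 : seq V).
Let P := nontrivial (u :: q1) ++ nontrivial (v :: q2).
Let t := link u q1 v q2.
Hypothesis dP : disjoint_paths (P ++ C).
Hypothesis dt : disjoint_paths (t :: C).

Let t_outside x : x \in t -> x \notin flatten C.
Proof. by case: (disjoint_paths_cons dt) => _ /(_ x). Qed.

Let uq1_outside x : x \in u :: q1 -> x \notin v :: q2.
Proof.
case/andP: dt => /=; rewrite cat_uniq /t /link cat_uniq.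
case/andP=> /and3P[_ H _] _ _ xq; apply: contra H => xv; apply/hasP.
by exists x; rewrite ?mem_rev.
Qed.

Lemma in_cover_link x :
  in_cover (t :: C) x = (x \in [:: u; v]) || in_cover (P ++ C) x.
Proof.
rewrite !in_coverE /= flatten_cat !mem_cat /t mem_rev orbA; congr orb.
rewrite /P flatten_cat mem_cat /nontrivial !inE.
case: q1 => [|y p]; case: q2 => [|z p'] /=; rewrite ?cats0 ?inE ?orbF;
  by case: (x == u); case: (x == v); rewrite /= ?orbT ?orbF.
Qed.

Lemma cover_edges_link e : (e \in cover_edges (t :: C)) =
  (e == edge (u, v)) || (e \in cover_edges (P ++ C)).
Proof.
rewrite !cover_edgesE /= has_cat /t path_edges_link !inE -!orbA; congr (_ || _).
rewrite !orbA; congr orb; rewrite has_cat /nontrivial; congr orb.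
  by case: q1 => [|y p] /=; rewrite ?path_edges1 ?inE ?orbF.
by case: q2 => [|y p] /=; rewrite ?path_edges1 ?inE ?orbF.
Qed.

Lemma endpoint_outside x : x \notin t -> endpoint_in (t :: C) x = endpoint_in C x.
Proof.
by move=> xt /=; case: (boolP (is_endpoint x t)) xt => // /is_endpoint_mem ->.
Qed.

Lemma endpoint_inside x : x \in t ->
  endpoint_in (t :: C) x = (x \in [:: last u q1; last v q2]).
Proof.
move=> xt; rewrite /= endpoint_link !inE.
have /negbTE -> : ~~ endpoint_in C x; last by rewrite orbF.
by apply: contra (t_outside xt) => /endpoint_in_cover; rewrite in_coverE.
Qed.

Lemma inside_not_end x : x \in t -> x \notin [:: u; v; last u q1; last v q2] ->
  x \in flatten P /\ ~~ endpoint_in (P ++ C) x.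
Proof.
move=> xt; rewrite !inE !negb_or => /and4P[xu xv xa xb].
have nC : ~~ endpoint_in C x.
  by apply: contra (t_outside xt) => /endpoint_in_cover; rewrite in_coverE.
have nP w q : x != w -> x != last w q -> ~~ endpoint_in (nontrivial (w :: q)) x.
  move=> xw xl; apply/negP => E; move: (E); have /endpoint_in_cover := E.
  by rewrite in_coverE => /endpoint_nontrivial ->; rewrite (negbTE xw) (negbTE xl).
rewrite /P /endpoint_in !has_cat !negb_or [has _ C in X in _ && X]/= nC !nP //.
split=> //; rewrite flatten_cat mem_cat.
move: xt; rewrite mem_link !inE (negbTE xu) (negbTE xv) /=.
by case/orP => /flatten_nontrivial_tail ->; rewrite ?orbT.
Qed.

(** Away from the new path nothing changes. On it, only its two ends are
    found: u and v have no entry any more unless they are these ends, and the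
    other vertices were interior already. *)
Lemma end_spec_link (en en' : V -> option (V * rope V)) r1 r2 :
    (forall x, end_spec (P ++ C) x (en x)) ->
    en' (last u q1) = Some (last v q2, r1) -> flat r1 = t ->
    en' (last v q2) = Some (last u q1, r2) -> flat r2 = rev t ->
    (forall x, x \notin [:: last u q1; last v q2] ->
       en' x = if x \in [:: u; v] then None else en x) ->
  forall x, end_spec (t :: C) x (en' x).
Proof.
move=> enP ea r1t eb r2t enx x.
have tt : traversal (t :: C) t by rewrite /traversal mem_head.
have [->|xa] := eqVneq x (last u q1).
  by rewrite ea /= r1t tt /t head_link last_link !eqxx.
have [->|xb] := eqVneq x (last v q2).
  by rewrite eb /= r2t traversal_rev tt rev_link head_link last_link !eqxx.
rewrite enx ?inE ?negb_or ?xa //; case: ifPn => [xuv|].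
  have xt : x \in t by rewrite mem_link !inE; case/orP: xuv => ->; rewrite ?orbT.
  by rewrite /end_spec endpoint_inside // !inE negb_or xa.
rewrite negb_or => /andP[xu xv].
have [xt|xt] := boolP (x \in t).
  have [] := inside_not_end xt; rewrite ?inE ?negb_or ?xu ?xv ?xa //.
  move=> _ nE; have /andP[_ sP] := dP.
  move: nE; rewrite (end_spec_endpoint sP (enP x)); case: (en x) => // _.
  by rewrite /end_spec endpoint_inside // !inE negb_or xa.
apply: end_spec_cons => //; have /andP[_ sP] := dP.
apply: end_spec_outside sP _ (enP x); apply: contra xt.
rewrite mem_link /P flatten_cat mem_cat.
by case/orP => /flatten_nontrivial ->; rewrite ?orbT.
Qed.

Lemma interior_link : interior (P ++ C) \subset interior (t :: C).
Proof.
apply/fintype.subsetP => x; rewrite !inE => /andP[xP nE].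
rewrite in_cover_link xP orbT andTb.
have [xt|xt] := boolP (x \in t); last first.
  rewrite endpoint_outside //; apply: contra nE.
  by rewrite /endpoint_in has_cat orbC => ->.
rewrite endpoint_inside //; apply: contra nE.
have xf : x \in flatten P.
  move: xP; rewrite in_coverE flatten_cat mem_cat (negbTE (t_outside xt)) orbF.
  by [].
rewrite /endpoint_in has_cat; move: xf.
rewrite /P flatten_cat mem_cat has_cat !inE => xf xab; apply/orP; left.
have la w q : last w q \in w :: q by exact: mem_last.
case/orP: xf => xf; apply/orP; [left|right]; rewrite -/(endpoint_in _ _);
  rewrite endpoint_nontrivial //; have xq := flatten_nontrivial xf.
  case/orP: xab => [->|/eqP E]; first by rewrite orbT.
  by move: (uq1_outside xq); rewrite E la.
case/orP: xab => [/eqP E|->]; last by rewrite orbT.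
by move: (uq1_outside (la u q1)); rewrite -E xq.
Qed.

(** The ends of the linking edge become interior, unless they were alone. *)
Lemma interior_link_ends :
  (q1 != [::] -> u \in interior (t :: C) :\: interior (P ++ C)) /\
  (q2 != [::] -> v \in interior (t :: C) :\: interior (P ++ C)).
Proof.
have aux w : w \in [:: u; v] -> w \in t -> w \notin [:: last u q1; last v q2] ->
    endpoint_in P w -> w \in interior (t :: C) :\: interior (P ++ C).
  move=> wuv wt wab wP.
  rewrite !inE in_cover_link wuv orTb andTb endpoint_inside // wab.
  by rewrite {1}/endpoint_in has_cat -/(endpoint_in _ _) wP andbF.
have ends w q : q != [::] -> endpoint_in (nontrivial (w :: q)) w.
  by case: q => // y q _; rewrite /endpoint_in /= eqxx.
have /andP[uq1 uq2] : uniq (u :: q1) && uniq (v :: q2).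
  case/andP: dt; rewrite [flatten _]/= cat_uniq {1}/t /link cat_uniq rev_uniq.
  by case/andP=> /and3P[-> _ ->].
have lastN w q : q != [::] -> uniq (w :: q) -> w != last w q.
  case: q => // y q _ /andP[wq _]; apply: contra wq => /eqP E.
  by rewrite [X in X \in _]E /= mem_last.
have uqv : u != last v q2.
  by apply: contra (uq1_outside (mem_head u q1)) => /eqP ->; exact: mem_last.
have vqu : v != last u q1.
  by apply: contraTN (mem_head v q2) => /eqP {1}->; exact/uq1_outside/mem_last.
split=> qn; apply: aux; rewrite ?mem_link ?inE ?eqxx ?orbT ?negb_or ?lastN //=.
- by rewrite /P /endpoint_in has_cat -/(endpoint_in _ _) ends.
- by rewrite vqu.
- by rewrite /P /endpoint_in has_cat orbC -/(endpoint_in _ _) ends.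
Qed.

End Link.


Lemma end_spec_perm C D x o : perm_eq C D -> end_spec C x o = end_spec D x o.
Proof.
move=> CD; rewrite /end_spec /traversal /endpoint_in.
by case: o => [[a r]|]; rewrite ?(eq_has_r (perm_mem CD)) ?(perm_mem CD).
Qed.

End Paths.

(** * Dictionaries that describe a cover *)

Section State.
Variable V : finType.
Implicit Types (C : seq (seq V)) (st : state V) (u v a b x : V).
Local Open Scope fmap_scope.

(** The cover C that the dictionaries of st represent is determined up to the
    order and the orientation of its paths. *)
Record tracks C st : Prop := Tracks {
  tracks_disjoint : disjoint_paths C;
  tracks_on_path : forall x, (x \in on_path st) = in_cover C x;
  tracks_path_edge : forall e, (e \in path_edge st) = (e \in cover_edges C);
  tracks_ends : forall x, end_spec C x (ends st).[? x] }.

Lemma tracks_perm C D st : perm_eq C D -> tracks C st -> tracks D st.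
Proof.
move=> CD [dC on pe en]; split=> [|x|e|x].
- by rewrite -(disjoint_paths_perm CD).
- by rewrite on /in_cover (eq_has_r (perm_mem CD)).
- by rewrite pe !cover_edgesE (eq_has_r (perm_mem CD)).
- by rewrite -(end_spec_perm _ _ CD).
Qed.

Lemma tracks_rev p C st : tracks (p :: C) st -> tracks (rev p :: C) st.
Proof.
move=> [dC on pe en]; split=> [|x|e|x].
- move: dC; rewrite /disjoint_paths /= size_rev.
  by rewrite -(perm_uniq (s1 := p ++ flatten C)) // perm_cat2r perm_sym perm_rev.
- by rewrite on /= mem_rev.
- by rewrite pe !cover_edgesE /= path_edges_rev.
- move: (en x); rewrite /end_spec /traversal /= is_endpoint_rev.
  case: (ends st).[? x] => [[a r]|] //.
  rewrite !inE (can_eq revK) (can2_eq revK revK).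
  by case: (flat r == p); case: (flat r == rev p); rewrite ?orbT.
Qed.

(** Isolates the path that starts at x, oriented away from x. *)
Lemma tracks_path_at C st x q : tracks C st -> traversal C (x :: q) ->
  tracks ((x :: q) :: rem (path_at C x) C) st.
Proof.
move=> tr tC; have [pC pE _] := path_atP (tracks_disjoint tr) tC.
have := tracks_perm (perm_to_rem pC) tr.
by case: pE => {1}-> // /tracks_rev; rewrite revK.
Qed.

Lemma tracks_endpoint C st x : tracks C st -> endpoint_in C x = (ends st).[? x].
Proof.
by move=> [/andP[_ sC] _ _ /(_ x)]; exact: end_spec_endpoint.
Qed.

Lemma tracks_traversal C st x a r : tracks C st -> (ends st).[? x] = Some (a, r) ->
  exists q, [/\ flat r = x :: q, last x q = a & traversal C (x :: q)].
Proof.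
move=> [/andP[_ sC] _ _ /(_ x)] + xE; rewrite xE; exact: end_specS.
Qed.

(** The traversal from the far end of a path is the reverse of the one from its
    near end. *)
Lemma tracks_far_end C st x a r : tracks C st -> (ends st).[? x] = Some (a, r) ->
  exists r', (ends st).[? a] = Some (x, r') /\ flat r' = rev (flat r).
Proof.
move=> tr xE; have [q [rE la tC]] := tracks_traversal tr xE; rewrite rE.
have tC' : traversal C (rev (x :: q)) by rewrite traversal_rev.
have [q' qE] : exists q', rev (x :: q) = a :: q'.
  by case/lastP: q la {rE tC tC'} => [|q y] <-;
    [exists [::]|exists (rev (x :: q)); rewrite last_rcons -rcons_cons rev_rcons].
rewrite qE in tC' *.
have := tracks_endpoint a tr; rewrite (traversal_endpoint tC').
case aE: (ends st).[? a] => [[b r']|] // _.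
have [q2 [r'E lb tC2]] := tracks_traversal tr aE.
have := path_atP (tracks_disjoint tr) tC'; have := path_atP (tracks_disjoint tr) tC2.
move=> [_ _ ->] [_ _ /(congr1 rev)]; rewrite !revK => E.
exists r'; rewrite r'E E; split=> //; rewrite -lb; congr (Some (_, _)).
have : last a (a :: q2) = x by rewrite E -qE rev_cons last_rcons.
by [].
Qed.

Lemma tracks_link C st st' u q1 v q2 a b (r1 r2 : rope V)
    (P := nontrivial (u :: q1) ++ nontrivial (v :: q2)) :
  tracks (P ++ C) st -> disjoint_paths (link u q1 v q2 :: C) ->
  last u q1 = a -> last v q2 = b ->
  (forall x, (x \in on_path st') = (x \in [:: u; v]) || (x \in on_path st)) ->
  (forall e, (e \in path_edge st') = (e == edge (u, v)) || (e \in path_edge st)) ->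
  (ends st').[? a] = Some (b, r1) -> flat r1 = link u q1 v q2 ->
  (ends st').[? b] = Some (a, r2) -> flat r2 = rev (link u q1 v q2) ->
  (forall x, x \notin [:: a; b] -> (ends st').[? x] =
     if x \in [:: u; v] then None else (ends st).[? x]) ->
  tracks (link u q1 v q2 :: C) st'.
Proof.
move=> [dC on pe en] dt la lb on' pe' ea r1E eb r2E ex; subst a b; split=> //.
- by move=> x; rewrite on' on in_cover_link.
- by move=> e; rewrite pe' pe cover_edges_link.
- pose en' x := (ends st').[? x].
  exact: (end_spec_link (en' := en') dC dt en ea r1E eb r2E ex).
Qed.

Lemma tracks_interior C st x : tracks C st ->
  (x \in interior C) = (x \in on_path st) && ~~ (ends st).[? x].
Proof. by move=> tr; rewrite inE -(tracks_endpoint x tr) -(tracks_on_path tr). Qed.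

(** The dictionaries decide which vertices are interior; so covers that differ by
    reorienting paths have the same interior vertices. *)
Lemma eq_interior C D st : tracks C st -> tracks D st -> interior C = interior D.
Proof.
move=> trC trD; apply/setP => x.
by rewrite (tracks_interior _ trC) (tracks_interior _ trD).
Qed.

End State.

(** * Processing the edges *)

Section Processing.
Variables (V : finType) (R : realType) (G : wgraph V R).
Variable adj : {fmap V -> seq V}.
Implicit Types (C : seq (seq V)) (D : {set {set V}}) (st : state V).
Implicit Types (u v a b x : V).
Local Open Scope fmap_scope.

Definition neighbours u : seq V := odflt [::] adj.[? u].

(** The list of st holds exactly the edges of G that are not in D. *)
Definition listed D st : Prop :=
  forall e, e \in edges G -> (e \in in_list st) = (e \notin D).

Lemma time_remove_edges u l pe d :
  time (remove_edges u l pe d) = (size l * 3).+1.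
Proof. by elim: l d => //= x l IH d; rewrite IH; case: _.[? _] => [[]|] /=; lia. Qed.

Lemma mem_remove_edges u l pe d e : (e \in value (remove_edges u l pe d)) =
  (e \in d) && ~~ ((e \notin pe) && (e \in [seq edge (u, x) | x <- l])).
Proof.
elim: l d => [|x l IH] d /=; first by rewrite andbF andbT.
rewrite IH in_cons; have := fndSome pe (edge (u, x)).
case: _.[? _] => [[]|] /= xpe.
  by have [->|] := eqVneq e (edge (u, x)); rewrite -?xpe.
by rewrite mem_remf1; have [->|] := eqVneq e (edge (u, x)); rewrite -?xpe ?andbF.
Qed.

Section Steps.
Hypothesis adj_neighbours : forall u x,
  (x \in neighbours u) = (edge (u, x) \in edges G).

Lemma edge_neighbours u e : e \in edges G ->
  (e \in [seq edge (u, x) | x <- neighbours u]) = (u \in e).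
Proof.
move=> eG; apply/idP/idP => [/mapP[x _ ->]|ue]; first by rewrite !inE eqxx.
apply/mapP.
have /eqP/cards2P[x [y [_ eE]]] := edges_card2 eG.
move: ue eG; rewrite eE !inE => /orP[] /eqP -> eG.
  by exists y; rewrite ?adj_neighbours.
by exists x; rewrite ?adj_neighbours edgeC.
Qed.

Lemma time_remove_incident u st :
  time (remove_incident adj u st) = (size (neighbours u) * 3 + 3)%N.
Proof. by rewrite /= time_remove_edges -/(neighbours u); lia. Qed.

Lemma on_path_remove_incident u st :
  on_path (value (remove_incident adj u st)) = on_path st.
Proof. by []. Qed.

Lemma remove_incidentP u C D st : tracks C st -> listed D st ->
  tracks C (value (remove_incident adj u st)) /\
  listed (D :|: (incident G u :\: cover_edges C)) (value (remove_incident adj u st)).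
Proof.
move=> tr li; split; first by case: tr => dC on pe en; split.
move=> e eG /=; rewrite mem_remove_edges (edge_neighbours _ eG) li //.
by rewrite (tracks_path_edge tr) !inE eG negb_or.
Qed.

(* Only the specifications above are used from here on. *)
#[local] Opaque remove_incident.

(** The cost of the removals made so far, apart from a constant for each of them:
    a vertex becomes interior in the very step that removes its edges. *)
Definition potential C : nat := \sum_(x in interior C) size (neighbours x) * 3.

(** The removals around the vertices of S, interior only from C' on, are paid. *)
Lemma potential_grow C C' (S : {set V}) :
  interior C \subset interior C' -> S \subset interior C' :\: interior C ->
  (potential C + \sum_(x in S) size (neighbours x) * 3 <= potential C')%N.
Proof.
move=> sub subS; rewrite [leqRHS](big_setID (interior C)) /=.
rewrite (finset.setIidPr sub) leq_add2l [leqRHS](big_setID S) /=.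
by rewrite (finset.setIidPr subS) leq_addr.
Qed.

(** r is a correct implementation of the step from C to s.1 that removes s.2, and
    costs at most k beyond the removals that it performs. *)
Definition step_ok k D st u v (r : cost (state V)) C
    (s : seq (seq V) * {set {set V}}) : Prop :=
  [/\ tracks s.1 (value r), listed (D :|: s.2) (value r),
      forall x, x \in on_path (value r) -> (x \in [:: u; v]) || (x \in on_path st)
    & (time r + potential C <= k + potential s.1)%N].

Lemma step_ok_le k k' D st u v r r' C s : step_ok k D st u v r C s ->
  value r' = value r -> (time r' + k <= time r + k')%N -> step_ok k' D st u v r' C s.
Proof. by move=> [tr li sub t] E t'; split; rewrite ?E //; lia. Qed.

Lemma step_ok_swap k D st u v r C s :
  step_ok k D st u v r C s -> step_ok k D st v u r C s.
Proof.
by move=> [tr li sub t]; split=> // x /sub; rewrite !inE !(orbC (x == u)).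
Qed.

(** Both u and v are linked as paths of a single vertex; no vertex becomes
    interior, so nothing is removed. *)
Lemma new_path_ok C D st u v : tracks C st -> listed D st -> u != v ->
  ~~ in_cover C u -> ~~ in_cover C v ->
  step_ok 6 D st u v (new_path u v st) C ([:: u; v] :: C, finset.set0).
Proof.
move=> tr li uv uC vC.
have dt : disjoint_paths ([:: u; v] :: C).
  have := tracks_disjoint tr; rewrite /disjoint_paths /= => /andP[-> ->].
  by rewrite !inE negb_or uv -!in_coverE uC vC.
have dC : disjoint_paths (nontrivial [:: u] ++ nontrivial [:: v] ++ C).
  exact: tracks_disjoint tr.
split.
- apply: (tracks_link (C := C) (q1 := [::]) (q2 := [::]) (st := st) (a := u) (b := v)
    (r1 := Join (Single u) (Single v)) (r2 := Join (Single v) (Single u))) => //=.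
  + by move=> x; rewrite !mem_setf !inE; do !bool_congr.
  + by move=> e; rewrite mem_setf !inE.
  + by rewrite fnd_set (negbTE uv) fnd_set eqxx.
  + by rewrite fnd_set eqxx.
  + move=> x; rewrite !inE negb_or => /andP[xu xv].
    by rewrite !fnd_set (negbTE xu) (negbTE xv).
- by move=> e eG; rewrite finset.setU0 li.
- by move=> x; rewrite /= !mem_setf !inE => /or3P[] ->; rewrite ?orbT.
- rewrite leq_add2l.
  have := @potential_grow C ([:: u; v] :: C) finset.set0.
  rewrite big_set0 addn0; apply; last exact: finset.sub0set.
  exact: (interior_link (q1 := [::]) (q2 := [::])).
Qed.

(** The path from u to a is linked to v alone. As the path has at least two
    vertices, u becomes interior, which pays for removing the edges at u. *)
Lemma extend_ok C D st u v a ru : tracks C st -> listed D st ->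
  (ends st).[? u] = Some (a, ru) -> ~~ in_cover C v ->
  let C' := rcons (ending_at u (path_at C u)) v :: rem (path_at C u) C in
  step_ok 9 D st u v (extend adj u v a ru st) C
    (C', incident G u :\: cover_edges C').
Proof.
move=> tr li uE vC.
have [q1 [ruE la tC]] := tracks_traversal tr uE.
have [ra [aE raE]] := tracks_far_end tr uE.
have [_ _ ->] := path_atP (tracks_disjoint tr) tC.
have tr' := tracks_path_at tr tC; move: (rem _ C) tr' => C0 tr'.
rewrite -cats1 -/(link u q1 v [::]) => C'.
have /andP[/= uC0 /andP[q1n sC0]] := tracks_disjoint tr'.
have q1n' : q1 != [::] by case: (q1) q1n.
have PE : (u :: q1) :: C0 = (nontrivial (u :: q1) ++ nontrivial [:: v]) ++ C0.
  by rewrite /nontrivial q1n.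
have vN : v \notin (u :: q1) ++ flatten C0.
  by move: vC; rewrite -(tracks_on_path tr) (tracks_on_path tr') in_coverE.
have dC' : disjoint_paths C'.
  rewrite disjoint_link sC0 andbT -cat1s.
  rewrite (perm_uniq (s2 := v :: u :: q1 ++ flatten C0)).
    by rewrite /= [v \notin _]vN.
  by rewrite perm_catCA.
have av : a != v.
  by apply: contraNneq vN => <-; rewrite mem_cat -la mem_last.
have uv : u != v by apply: contraNneq vN => <-; rewrite mem_head.
have vE : (ends st).[? v] = None.
  have := tracks_endpoint v tr; case: _.[? v] => // p /endpoint_in_cover.
  by rewrite (negbTE vC).
pose st1 := State (in_list st) (on_path st).[v <- tt]
    (path_edge st).[edge (u, v) <- tt]
    (ends st).[~ u].[a <- (v, Join ra (Single v))].[v <- (a, Join (Single v) ru)].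
have trS : tracks C' st1.
  apply: (tracks_link (st := st) (a := a) (b := v)
    (r1 := Join ra (Single v)) (r2 := Join (Single v) ru)) => //.
  - by rewrite -PE.
  - move=> x; rewrite /= mem_setf !inE; have [->|//] := eqVneq x u.
    rewrite (tracks_on_path tr) orbC /= endpoint_in_cover ?orbT //.
    exact: traversal_endpoint tC.
  - by move=> e; rewrite /= mem_setf !inE.
  - by rewrite /= fnd_set (negbTE av) fnd_set eqxx.
  - by rewrite flat_join raE ruE.
  - by rewrite /= fnd_set eqxx.
  - by rewrite flat_join rev_link ruE.
  - move=> x; rewrite !inE negb_or => /andP[xa xv].
    by rewrite /= !fnd_set (negbTE xa) (negbTE xv) fnd_rem1 orbF if_neg.
have [tr1 li1] := remove_incidentP u trS (D := D) li.
have valE : value (extend adj u v a ru st) = value (remove_incident adj u st1).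
  by rewrite /extend /= aE.
rewrite /step_ok {}valE; split=> //.
  move=> x; rewrite on_path_remove_incident mem_setf !inE.
  by case/orP=> ->; rewrite ?orbT.
have -> : time (extend adj u v a ru st) = (size (neighbours u) * 3 + 9)%N.
  by rewrite /extend /= time_remove_incident; lia.
suff : (potential C + size (neighbours u) * 3 <= potential C')%N.
  by rewrite [(_, _).1]/=; lia.
rewrite -(big_set1 addn u (fun x => size (neighbours x) * 3)%N).
rewrite /potential (eq_interior tr tr') PE.
apply: potential_grow; first exact: interior_link.
by rewrite finset.sub1set; have [+ _] := interior_link_ends dC'; apply.
Qed.

(** Both u and v become interior, which pays for both removals. *)
Lemma merge_paths_ok C D st u v a b ru rv : tracks C st -> listed D st -> u != v ->
  (ends st).[? u] = Some (a, ru) -> (ends st).[? v] = Some (b, rv) ->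
  path_at C u != path_at C v ->
  let p := path_at C u in let q := path_at C v in
  let C' := (ending_at u p ++ rev (ending_at v q)) :: rem q (rem p C) in
  step_ok 13 D st u v (merge_paths adj u v a b ru rv st) C
    (C', (incident G u :|: incident G v) :\: cover_edges C').
Proof.
move=> tr li uv uE vE pq p q.
have [q1 [ruE la tu]] := tracks_traversal tr uE.
have [q2 [rvE lb tv]] := tracks_traversal tr vE.
have [ra [aE raE]] := tracks_far_end tr uE.
have [rb [bE rbE]] := tracks_far_end tr vE.
have [pC pE] := path_atP (tracks_disjoint tr) tu; rewrite -/p in pC pE * => ->.
have [qC qE] := path_atP (tracks_disjoint tr) tv; rewrite -/q in qC qE * => ->.
rewrite revK -/(link u q1 v q2).
have tr' : tracks [:: u :: q1, v :: q2 & rem q (rem p C)] st.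
  have qpC : q \in rem p C.
    by move: qC; rewrite (perm_mem (perm_to_rem pC)) inE eq_sym (negbTE pq).
  have : tracks [:: p, q & rem q (rem p C)] st.
    apply: tracks_perm tr; apply: perm_trans (perm_to_rem pC) _.
    by rewrite perm_cons perm_to_rem.
  move: (rem q _) => C0 tr0.
  have {}tr0 : tracks [:: u :: q1, q & C0] st.
    by case: pE tr0 => -> // /tracks_rev; rewrite revK.
  have swap (x y : seq V) : perm_eq [:: x, y & C0] [:: y, x & C0].
    by rewrite (perm_catCA [:: x] [:: y]).
  have {}tr0 := tracks_perm (swap _ _) tr0.
  apply: tracks_perm (swap _ _) _.
  by case: qE tr0 => -> // /tracks_rev; rewrite revK.
move: (rem q _) tr' => C0 tr' C'.
have /andP[dC0 /= /and3P[q1n q2n sC0]] := tracks_disjoint tr'.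
have PE : [:: u :: q1, v :: q2 & C0] =
    (nontrivial (u :: q1) ++ nontrivial (v :: q2)) ++ C0.
  by rewrite /nontrivial q1n q2n.
have q1n' : q1 != [::] by case: (q1) q1n.
have q2n' : q2 != [::] by case: (q2) q2n.
have dC' : disjoint_paths C' by rewrite disjoint_link sC0 andbT.
have outside x : x \in u :: q1 -> x \notin v :: q2.
  move: dC0; rewrite [flatten _]/= -cat_cons cat_uniq => /and3P[_ + _] xq.
  apply: contra => xv; apply/hasP; exists x => //.
  by rewrite -cat_cons mem_cat xv.
have ab : a != b.
  apply: contraTneq (outside a _); last by rewrite -la mem_last.
  by move=> ->; rewrite negbK -lb mem_last.
pose st1 := State (in_list st) (on_path st) (path_edge st).[edge (u, v) <- tt]
    (ends st).[~ u].[~ v].[a <- (b, Join ra rv)].[b <- (a, Join rb ru)].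
have trS : tracks C' st1.
  apply: (tracks_link (st := st) (a := a) (b := b)
    (r1 := Join ra rv) (r2 := Join rb ru)) => //.
  - by rewrite -PE.
  - move=> x; rewrite /= !inE (tracks_on_path tr).
    have [->|_] := eqVneq x u.
      by rewrite endpoint_in_cover ?(traversal_endpoint tu).
    have [->|//] := eqVneq x v.
    by rewrite endpoint_in_cover ?(traversal_endpoint tv).
  - by move=> e; rewrite /= mem_setf !inE.
  - by rewrite /= fnd_set (negbTE ab) fnd_set eqxx.
  - by rewrite flat_join raE rvE ruE.
  - by rewrite /= fnd_set eqxx.
  - by rewrite flat_join rev_link rbE ruE rvE.
  - move=> x; rewrite !inE negb_or => /andP[xa xb].
    rewrite /= !fnd_set (negbTE xa) (negbTE xb) !fnd_rem1.
    by case: (x == u); case: (x == v).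
have [tr1 li1] := remove_incidentP u trS (D := D) li.
have [tr2 li2] := remove_incidentP v tr1 li1.
have valE : value (merge_paths adj u v a b ru rv st) =
    value (remove_incident adj v (value (remove_incident adj u st1))).
  by rewrite /merge_paths /= aE bE.
rewrite /step_ok {}valE; split=> //.
- by move=> e eG; rewrite li2 // !inE; do !bool_congr; rewrite andb_orr orbA.
- by move=> x; rewrite 2!on_path_remove_incident => xst; rewrite xst orbT.
have -> : time (merge_paths adj u v a b ru rv st) =
    (size (neighbours u) * 3 + size (neighbours v) * 3 + 13)%N.
  by rewrite /merge_paths /= !time_remove_incident; lia.
suff : (potential C + (size (neighbours u) * 3 + size (neighbours v) * 3) <=
    potential C')%N by rewrite [(_, _).1]/=; lia.
have <- : (\sum_(x in [set u; v]) size (neighbours x) * 3 =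
    size (neighbours u) * 3 + size (neighbours v) * 3)%N.
  by rewrite big_setU1 ?inE // big_set1.
rewrite /potential (eq_interior tr tr') PE.
apply: potential_grow; first exact: interior_link.
have [Hu Hv] := interior_link_ends dC'.
apply/fintype.subsetP => x; rewrite !inE => /orP[] /eqP ->.
  by have := Hu q1n'; rewrite !inE.
by have := Hv q2n'; rewrite !inE.
Qed.

#[local] Opaque new_path extend merge_paths.

(** If u and v are ends of one path, it is the path from u to v, as u != v. *)
Lemma same_path C st u v a b ru rv : tracks C st -> u != v ->
  (ends st).[? u] = Some (a, ru) -> (ends st).[? v] = Some (b, rv) ->
  (path_at C u == path_at C v) = (a == v).
Proof.
move=> tr uv uE vE.
have [q1 [_ <- tu]] := tracks_traversal tr uE.
have [q2 [_ _ tv]] := tracks_traversal tr vE.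
have dC := tracks_disjoint tr.
have [pC pE _] := path_atP dC tu; have [qC qE _] := path_atP dC tv.
apply/eqP/eqP => [E|E]; last first.
  apply: (path_unique (x := v) dC) => //.
    by case: pE => ->; rewrite ?mem_rev -E mem_last.
  by case: qE => ->; rewrite ?mem_rev mem_head.
have : u :: q1 = v :: q2 \/ u :: q1 = rev (v :: q2).
  case: pE qE => p1 [] p2; [left|right|right|left].
  - by rewrite -p1 E p2.
  - by rewrite -p1 E p2.
  - by rewrite -p2 -E p1 revK.
  - by rewrite -[LHS]revK -p1 E p2 revK.
case=> [[/eqP]|/(congr1 (last u))]; first by rewrite (negbTE uv).
by rewrite rev_cons last_rcons.
Qed.

Lemma process_ok C D st u v : tracks C st -> listed D st ->
  edge (u, v) \in edges G -> edge (u, v) \notin D ->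
  step_ok 19 D st u v (process adj u v st) C (step G u v C).
Proof.
move=> tr li uvG uvD.
have uv : u != v.
  apply: contraTneq (uvG) => ->; apply/negP => /edges_card2.
  by rewrite /edge finset.setUid cards1.
have present : (in_list st).[? edge (u, v)] = Some tt.
  have := fndSome (in_list st) (edge (u, v)); rewrite li // uvD.
  by case: _.[? _] => [[]|].
have ucov := tracks_on_path tr u; have vcov := tracks_on_path tr v.
have uend := tracks_endpoint u tr; have vend := tracks_endpoint v tr.
have uec : endpoint_in C u -> in_cover C u by exact: endpoint_in_cover.
have vec : endpoint_in C v -> in_cover C v by exact: endpoint_in_cover.
have idle r : r = ret st -> step_ok 6 D st u v r C (C, finset.set0).
  move=> ->; split=> //=; last by lia.
    by move=> e eG; rewrite finset.setU0 li.
  by move=> x ->; rewrite orbT.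
rewrite -fndSome in ucov; rewrite -fndSome in vcov.
rewrite /process /lookup /bind /tick /= present /step.
(* Of the 16 outcomes of the four lookups, those with an end off the paths are
   impossible. *)
case pu: (on_path st).[? u] ucov => [[]|] /= ucov;
case pv: (on_path st).[? v] vcov => [[]|] /= vcov;
case uE: (ends st).[? u] uend => [[a ru]|] /= uend;
case vE: (ends st).[? v] vend => [[b rv]|] /= vend;
move: uec vec; rewrite -?ucov -?vcov ?uend ?vend => uec vec /=;
  try by [have := uec isT | have := vec isT].
- rewrite -(same_path tr uv uE vE); case: ifPn => uvp.
    exact: step_ok_le (idle _ _) _ _.
  by apply: step_ok_le (merge_paths_ok tr li uv uE vE uvp) _ _ => //=; lia.
- exact: step_ok_le (idle _ _) _ _.
- exact: step_ok_le (idle _ _) _ _.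
- exact: step_ok_le (idle _ _) _ _.
- apply: step_ok_le (extend_ok tr li uE _) _ _ => //; first by rewrite -vcov.
  by rewrite /=; lia.
- exact: step_ok_le (idle _ _) _ _.
- apply/step_ok_swap; apply: step_ok_le (extend_ok tr li vE _) _ _ => //.
    by rewrite -ucov.
  by rewrite /=; lia.
- exact: step_ok_le (idle _ _) _ _.
- apply: step_ok_le (new_path_ok tr li uv _ _) _ _ => //=; last lia;
    by rewrite -?ucov -?vcov.
Qed.

(** The bound 20 per edge is the 19 of a step and one for the recursive call; the
    removals are charged to the potential. *)
Lemma process_all_ok (L : seq (V * V)) C D st (C' := run G L D C)
    (r := process_all adj L st) : tracks C st -> listed D st ->
    (forall e, e \in L -> edge e \in edges G) ->
  [/\ tracks C' (value r),
      forall x, x \in on_path (value r) ->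
        (x \in flatten [seq [:: e.1; e.2] | e <- L]) || (x \in on_path st)
    & (time r + potential C <= size L * 20 + 1 + potential C')%N].
Proof.
rewrite {}/C' {}/r; elim: L C D st => [|[u v] L IH] C D st tr li LG.
  by split.
have LG' e : e \in L -> edge e \in edges G.
  by move=> eL; apply: LG; rewrite inE eL orbT.
have uvG : edge (u, v) \in edges G by rewrite LG ?mem_head.
have [uvD|uvD] := boolP (edge (u, v) \in D).
  have absent : process adj u v st = Cost st 1.
    have := fndSome (in_list st) (edge (u, v)); rewrite li // uvD.
    by rewrite /process /bind /lookup /tick /=; case: _.[? _].
  have [tr' sub t] := IH C D st tr li LG'.
  rewrite [run _ _ _ _]/= uvD [process_all _ _ _]/= absent /bind /=; split=> //.
    by move=> x /sub; rewrite !inE => /orP[] ->; rewrite ?orbT.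
  by rewrite /=; lia.
have [tr1 li1 sub1 t1] := process_ok tr li uvG uvD.
rewrite [run _ _ _ _]/= (negbTE uvD) [process_all _ _ _]/=.
case: (step G u v C) tr1 li1 t1 => C1 X /= tr1 li1 t1.
have [tr' sub t] := IH C1 (D :|: X) _ tr1 li1 LG'.
split=> //=; last by lia.
move=> x /sub /orP[xL|/sub1]; first by rewrite !inE xL !orbT.
by rewrite !inE -!orbA => /or3P[] ->; rewrite ?orbT.
Qed.

Lemma potential_max C : (potential C <= \sum_x size (neighbours x) * 3)%N.
Proof. by rewrite [leqRHS](bigID (mem (interior C))) /= leq_addr. Qed.

End Steps.
End Processing.

(** * Building the dictionaries and reading off the paths *)

Section Input.
Variable V : finType.
Implicit Types (s : seq (V * V)) (u v x : V).
Local Open Scope fmap_scope.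

Lemma time_fill_list s d : time (fill_list s d) = (size s * 2 + 1)%N.
Proof. by elim: s d => //= e s IH d; rewrite IH; lia. Qed.

Lemma mem_fill_list s d e :
  (e \in value (fill_list s d)) = (e \in [seq edge f | f <- s]) || (e \in d).
Proof.
elim: s d => //= f s IH d; rewrite IH mem_setf !inE.
by rewrite orbCA orbA.
Qed.

Lemma neighbours_add u v adj x : neighbours (value (add_neighbour u v adj)) x =
  if x == u then v :: neighbours adj u else neighbours adj x.
Proof. by rewrite /neighbours /= fnd_set; case: eqP. Qed.

Lemma time_fill_adj s adj : time (fill_adj s adj) = (size s * 7 + 1)%N.
Proof. by elim: s adj => //= -[u v] s IH adj; rewrite /= IH; lia. Qed.

Lemma mem_fill_adj s adj u x : (x \in neighbours (value (fill_adj s adj)) u) =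
  [|| (u, x) \in s, (x, u) \in s | x \in neighbours adj u].
Proof.
elim: s adj => //= -[y z] s IH adj.
have add v w adj' : (x \in neighbours (value (add_neighbour v w adj')) u) =
    (u == v) && (x == w) || (x \in neighbours adj' u).
  by rewrite neighbours_add; case: eqP => [->|_]; rewrite ?inE.
rewrite [value _]/= IH !add !in_cons !xpair_eqE [(x == y) && _]andbC.
by do ![case: (_ && _); rewrite ?orbT //=].
Qed.

Lemma sum_neighbours_add u v adj :
  (\sum_x size (neighbours (value (add_neighbour u v adj)) x) =
   (\sum_x size (neighbours adj x)).+1)%N.
Proof.
rewrite (bigD1 u) //= [in RHS](bigD1 u) //= neighbours_add eqxx /= addSn.
by congr (_ + _).+1; apply: eq_bigr => x /negbTE xu; rewrite neighbours_add xu.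
Qed.

(** Each edge adds one neighbour to each of its two ends. *)
Lemma sum_neighbours s adj : (\sum_x size (neighbours (value (fill_adj s adj)) x) =
  \sum_x size (neighbours adj x) + size s * 2)%N.
Proof.
elim: s adj => [|[u v] s IH] adj; first by rewrite addn0.
by rewrite [value _]/= IH !sum_neighbours_add /=; lia.
Qed.

End Input.

Section Output.
Variable V : finType.
Implicit Types (C : seq (seq V)) (s : seq (V * V)) (en : {fmap V -> V * rope V}).
Implicit Types (u v x : V).
Local Open Scope fmap_scope.

(** The part of [tracks] that matters to the output. *)
Definition ends_of C en : Prop :=
  disjoint_paths C /\ forall x, end_spec C x en.[? x].

(** C' is C without the path that ends at u, if any. Its vertices pay for
    flattening its rope. *)
Lemma emit_ok C en out u (r := emit u en out) : ends_of C en -> exists C',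
  [/\ ends_of C' (value r).1,
      forall x, endpoint_in C' x -> (x != u) && endpoint_in C x,
      perm_eq (map (@path_edges V) (C' ++ (value r).2))
              (map (@path_edges V) (C ++ out))
    & (time r + size (flatten C') * 2 <= 4 + size (flatten C) * 2)%N].
Proof.
rewrite {}/r => -[dC enC]; have /andP[_ sC] := dC.
rewrite /emit /bind /lookup /tick /=; move: (enC u).
case uE: en.[? u] => [[a r]|] /= nu; last first.
  exists C; split=> //; last by lia.
  by move=> x xC; rewrite xC andbT; apply: contraNneq nu => <-.
have [q [rE la tC]] := end_specS sC nu.
have [pC pE _] := path_atP dC tC; move: (path_at C u) pC pE => p pC pE.
have CE := perm_to_rem pC; move: (rem p C) CE => C0 CE; exists C0.
have endp x : is_endpoint x p = (x == u) || (x == a).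
  by case: pE => ->; rewrite ?is_endpoint_rev is_endpointE la.
have [dC0 pC0] : disjoint_paths C0 /\ forall x, x \in p -> x \notin flatten C0.
  by apply: disjoint_paths_cons; rewrite -(disjoint_paths_perm CE).
have nE x : x \in p -> ~~ endpoint_in C0 x.
  by move=> /pC0; apply: contra => /endpoint_in_cover; rewrite in_coverE.
have epC x : endpoint_in C x = is_endpoint x p || endpoint_in C0 x.
  by rewrite /endpoint_in (eq_has_r (perm_mem CE)).
split.
- split=> // x; rewrite !fnd_rem1.
  have [->|xa] := eqVneq x a.
    by apply: nE; rewrite is_endpoint_mem // endp eqxx orbT.
  have [->|xu] /= := eqVneq x u.
    by apply: nE; rewrite is_endpoint_mem // endp eqxx.
  have := enC x; have := end_spec_endpoint sC (enC x).
  have [xp|xp] := boolP (x \in p).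
    rewrite epC endp (negbTE xu) (negbTE xa) (negbTE (nE x xp)) /=.
    by case: en.[? x] => // _ _; exact: nE.
  rewrite (end_spec_perm _ _ CE) -cat1s => _; apply: end_spec_outside.
    by rewrite -(perm_all _ CE).
  by rewrite /= cats0.
- move=> x xC0; rewrite epC xC0 orbT andbT.
  by apply: contraTneq xC0 => ->; apply: nE; rewrite is_endpoint_mem // endp eqxx.
- have E : path_edges (flat r) = path_edges p.
    by rewrite rE; case: pE => ->; rewrite ?path_edges_rev.
  rewrite -/(flat r) !map_cat map_cons E -cat1s catA perm_cat2r perm_catC perm_sym.
  exact: (perm_map _ CE).
- rewrite (perm_size (perm_flatten CE)) /= size_cat.
  have := time_vertices r [::]; rewrite rE.
  have -> : size p = size (u :: q) by case: pE => ->; rewrite ?size_rev.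
  by lia.
Qed.

(** Every path has an end, and the ends are all visited; so no path is left. *)
Lemma emit_all_ok s C en out (r := emit_all s en out) : ends_of C en ->
    (forall x, endpoint_in C x -> x \in flatten [seq [:: e.1; e.2] | e <- s]) ->
  perm_eq (map (@path_edges V) (value r)) (map (@path_edges V) (C ++ out)) /\
  (time r <= size s * 9 + 1 + size (flatten C) * 2)%N.
Proof.
rewrite {}/r; elim: s C en out => [|[u v] s IH] C en out enC sub.
  case: C enC sub => [|[|x p] C] [/andP[_ sC] _] //.
  by move=> /(_ x); rewrite /= eqxx => /(_ isT).
have [C1 [en1 sub1 perm1 t1]] := emit_ok out u enC.
have [C2 [en2 sub2 perm2 t2]] := emit_ok (value (emit u en out)).2 v en1.
have rest x : endpoint_in C2 x -> x \in flatten [seq [:: e.1; e.2] | e <- s].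
  move=> /sub2/andP[xv /sub1/andP[xu /sub]].
  by rewrite /= !inE (negbTE xu) (negbTE xv).
have [perm3 t3] := IH C2 _ (value (emit v (value (emit u en out)).1
                                          (value (emit u en out)).2)).2 en2 rest.
split; last by rewrite /=; move: t1 t2 t3 => /=; lia.
exact: perm_trans (perm_trans perm3 perm2) perm1.
Qed.

End Output.

(** * Correctness and cost of the whole algorithm *)

Section Main.
Variables (V : finType) (R : realType) (G : wgraph V R).
Variable tie : V * V -> V * V -> bool.
Variable s : seq (V * V).
Hypothesis Gs : edge_list G s.
Local Open Scope fmap_scope.

Let heavier : rel (V * V) :=
  fun e f => (weight G (edge f) <= weight G (edge e))%R.

Let L := value (merge_sort (before (weight G) tie) (size s) s).
Let d := value (fill_list s [fmap]).
Let adj := value (fill_adj s [fmap]).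
Let st0 : state V := State d [fmap] [fmap] [fmap].

Let permL : perm_eq L s.
Proof. exact: perm_merge_sort. Qed.

Let edgesE e : (e \in edges G) = (e \in [seq edge f | f <- s]).
Proof. by rewrite (perm_mem Gs) mem_enum. Qed.

Lemma size_edge_list : size s = #|edges G|.
Proof. by rewrite cardE -(perm_size Gs) size_map. Qed.

Lemma sorted_list : sorted heavier L.
Proof.
apply: sorted_merge_sort => // x y; rewrite /before /bind /tick /= /heavier.
  by case/orP=> [/ltW|/andP[/eqP ->]].
by rewrite negb_or -leNgt => /andP[].
Qed.

Lemma neighbours_edges u x : (x \in neighbours adj u) = (edge (u, x) \in edges G).
Proof.
have -> : neighbours adj u = neighbours (value (fill_adj s [fmap])) u by [].
rewrite mem_fill_adj edgesE [neighbours [fmap] u]/neighbours fnd_fmap0 in_nil orbF.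
apply/idP/idP => [/orP[us|us]|/mapP[[y z] yzs /edge_inj]]; try apply/mapP.
- by exists (u, x).
- by exists (x, u); rewrite // edgeC.
- by case=> [[-> ->]|[-> ->]]; rewrite yzs ?orbT.
Qed.

Lemma tracks_start : tracks [::] st0.
Proof.
split=> [|x|e|x] //=; last by rewrite fnd_fmap0.
by rewrite -fndSome fnd_fmap0 cover_edgesE.
Qed.

Lemma listed_start : listed G finset.set0 st0.
Proof.
by move=> e; rewrite edgesE => es; rewrite /= mem_fill_list es finset.in_set0.
Qed.

Let run_ok := process_all_ok neighbours_edges tracks_start listed_start (L := L).
Let st1 := value (process_all adj L st0).
Let C := run G L finset.set0 [::].

(** 26 M = 20 M for the steps and 3 * 2 M for the removals. *)
Lemma sopc_run :
  [/\ tracks C st1,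
      {subset flatten C <= flatten [seq [:: e.1; e.2] | e <- s]}
    & (time (process_all adj L st0) <= size s * 26 + 1)%N].
Proof.
have [|tr sub t] := run_ok.
  by move=> e eL; rewrite edgesE map_f // -(perm_mem permL).
split=> //.
  move=> x; rewrite -in_coverE -(tracks_on_path tr) => /sub.
  rewrite -[x \in [fmap]]fndSome fnd_fmap0 orbF.
  move=> /flattenP[p /mapP[e eL ->] xe].
  apply/flattenP; exists [:: e.1; e.2] => //.
  by apply/mapP; exists e; rewrite -?(perm_mem permL).
have pot : (potential adj C <= size s * 6)%N.
  apply: leq_trans (potential_max adj C) _; rewrite -big_distrl /= sum_neighbours.
  by rewrite big1 => [|x _]; [lia|rewrite /neighbours fnd_fmap0].
have sizeL : size L = size s by exact: perm_size.
by move: t pot; rewrite sizeL -/C; lia.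
Qed.

Lemma sopc_correct : sopc_output G (value (sopc (weight G) tie s)).
Proof.
have [tr sub _] := sopc_run.
exists L; split; [|exact: sorted_list|].
  by apply: perm_trans Gs; apply: perm_map.
have [||+ _] := @emit_all_ok _ s C (ends st1) [::].
- by case: tr.
- by move=> x /endpoint_in_cover; rewrite in_coverE => /sub.
- by rewrite cats0.
Qed.

(** The terms of 51 come from sorting (3), filling the two dictionaries (2 and 7),
    the run (26) and the output (9 for the visits, 4 for the vertices). *)
Lemma time_sopc k : (size s <= 2 ^ k)%N ->
  (time (sopc (weight G) tie s) <= 5 * k * size s + 51 * size s + 5)%N.
Proof.
move=> sk; have [tr sub t] := sopc_run.
have [||_ te] := @emit_all_ok _ s C (ends st1) [::].
- by case: tr.
- by move=> x /endpoint_in_cover; rewrite in_coverE => /sub.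
have sizeC : (size (flatten C) <= size s * 2)%N.
  have /andP[uC _] := tracks_disjoint tr.
  apply: leq_trans (uniq_leq_size uC sub) _.
  by elim: (s) => //= e s' IH; lia.
have tm : (time (merge_sort (before (weight G) tie) (size s) s) <=
    5 * k * size s + 3 * size s + 1)%N.
  have [s0|s0] := posnP (size s).
    by rewrite s0 (size0nil s0) !muln0.
  have : (time (merge_sort (before (weight G) tie) (size s) s) + 2 <=
      5 * k * size s + 3 * size s)%N.
    by apply: time_merge_sort; rewrite ?s0.
  by lia.
rewrite /sopc /bind /= -/L -/d -/adj -/st0 -/st1 time_fill_list time_fill_adj.
by move: t te tm sizeC; lia.
Qed.

End Main.

Local Open Scope classical_set_scope.
Local Open Scope ring_scope.

Lemma trunc_log_ln2 (R : realType) (n : nat) : (0 < n)%N ->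
  (trunc_log 2 n)%:R * ln 2 <= ln n%:R :> R.
Proof.
move=> n0; rewrite mulr_natl -lnXn // ler_ln ?posrE ?exprn_gt0 ?ltr0n //.
by rewrite -natrX ler_nat trunc_logP.
Qed.

Theorem mainTheorem2 (R : realType) :
  exists T : nat -> R,
    T =O_\oo (fun M : nat => M%:R * ln M%:R) /\
    forall (V : finType) (G : wgraph V R) (tie : V * V -> V * V -> bool)
      (s : seq (V * V)),
      edge_list G s ->
      sopc_output G (value (sopc (weight G) tie s)) /\
      (time (sopc (weight G) tie s))%:R <= T #|edges G|.
Proof.
exists (fun M => (5 * (trunc_log 2 M).+1 * M + 51 * M + 5)%N%:R); split; last first.
  move=> V G tie s Gs; split; first exact: sopc_correct.
  rewrite ler_nat -(size_edge_list Gs) time_sopc //.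
  exact/ltnW/trunc_log_ltn.
have ln2 : 0 < ln 2 :> R by rewrite ln_gt0 // ltr1n.
(* With k = trunc_log 2 M, both k * ln 2 and ln 2 are at most ln M; hence ln 2
   times the cost is at most 5 (2 ln M) M + 51 M ln M + 5 M ln M. *)
apply/eqO_exP; exists (66 / ln 2); first by rewrite divr_gt0.
near=> M.
have M2 : (2 <= M)%N by near: M; exact: nbhs_infty_ge.
have M0 : 0 < M%:R :> R by rewrite ltr0n; lia.
have lnM : ln 2 <= ln M%:R :> R by rewrite ler_ln ?posrE // ler_nat.
have logM := @trunc_log_ln2 R M ltac:(lia).
rewrite ger0_norm ?ler0n // ger0_norm; last first.
  by rewrite mulr_ge0 ?ltW // (lt_le_trans ln2).
have costE k : (5 * k.+1 * M + 51 * M + 5)%N%:R =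
    5 * (k%:R + 1) * M%:R + 51 * M%:R + 5 :> R.
  by rewrite natr1 -!natrM -!natrD.
rewrite costE [leRHS]mulrAC ler_pdivlMr //.
have M1 : 1 <= M%:R :> R by rewrite ler1n; lia.
set t := (trunc_log 2 M)%:R in logM *; set m := M%:R in M0 M1 lnM logM *.
set l := ln 2 in ln2 lnM logM *; set x := ln m in lnM logM *.
have h1 : t * l * m <= x * m by rewrite ler_pM2r.
have h2 : l * m <= x * m by rewrite ler_pM2r.
have h3 : x <= x * m by rewrite ler_peMr // ltW // (lt_le_trans ln2).
by nra.
Unshelve. all: by end_near.
Qed.
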